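(* Let $\Omega=(a,b)$ be partitioned by $\alpha\in(a,b)$ into $\Omega_1=(a,\alpha)$ and $\Omega_2=(\alpha,b)$. There exists a constant $C=C(\gamma_1,\gamma_2,|\Omega|)$, independent of the horizon parameters $\delta_1,\delta_2>0$, such that the following holds. Suppose $u_i\in C(\Omega_i\cup\mathcal{I}_i)$, $i=1,2$, satisfy (i) $\mathcal{L}_iu_i\le 0$ in $\Omega_i$, for $i=1,2$; (ii) $u_1(x)=u_2(x)$ for all $x\in\Gamma$; (iii) $\mathcal{F}(u_1,u_2)(x)\le 0$ for all $x\in\Gamma$; and in addition $u_i\in C_b^2(\Omega_i\cup\mathcal{I}_i^D)$ for $i=1,2$. Then $$\|u\|_{\infty,\Omega}\le C\big(\|u\|_{\infty,\mathcal{I}^D}+\|\mathcal{L}u\|_{\infty,\Omega}+\|\mathcal{F}(u_1,u_2)\|_{\infty,\Gamma}\big).$$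
   Context: Geometry. $0<\delta_1\le\delta_2$; $\mathcal{I}_1^D=(a-\delta_1,a)$, $\mathcal{I}_2^D=(b,b+\delta_2)$, $\mathcal{I}^D=\mathcal{I}_1^D\cup\mathcal{I}_2^D$, $\mathcal{I}_1^J=(\alpha,\alpha+\delta_1)$, $\mathcal{I}_2^J=(\alpha-\delta_2,\alpha)$, $\mathcal{I}_i=\mathcal{I}_i^D\cup\mathcal{I}_i^J$, $\Gamma=(\alpha-\delta_2,\alpha+\delta_1)$, $\Omega_2^J=(\alpha+\delta_1,\alpha+\delta_2)$. The horizons are such that $\mathcal{I}_2^J\subset\Omega_1$ and $\mathcal{I}_1^J\subset\Omega_2$. Endpoints of intervals are treated as negligible (so $\Omega_1\cup\mathcal{I}_1$ is $(a-\delta_1,\alpha+\delta_1)$ and $\Omega_2\cup\mathcal{I}_2$ is $(\alpha-\delta_2,b+\delta_2)$ up to endpoints). Kernels. For $i=1,2$, $\gamma_{\delta_i}(x,y)=\delta_i^{-3}\gamma_i\big((x-y)/\delta_i\big)$, where $\gamma_i$ is nonnegative, even, locally integrable, compactly supported in $|s|<1$, with $\frac12\int_{-1}^1 s^2\gamma_i(s)\,ds=\sigma_i>0$. In particular $\gamma_{\delta_i}(x,y)=\gamma_{\delta_i}(y,x)\ge0$ and $\gamma_{\delta_i}(x,y)=0$ for $|x-y|>\delta_i$. Operators. $\mathcal{L}_iu_i(x)=\int_{\Omega_i\cup\mathcal{I}_i}[u_i(x)-u_i(y)]\gamma_{\delta_i}(x,y)\,dy$ for $x\in\Omega_i$. The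 interface flux operator is $$\mathcal{F}(u_1,u_2)(x)=\int_{\Omega_2^J}[u_2(x)-u_2(y)]\gamma_{\delta_2}(x,y)\,dy+\tfrac12\int_{\mathcal{I}_1^J}[u_1(x)-u_1(y)](\gamma_{\delta_2}(x,y)-\gamma_{\delta_1}(x,y))\,dy,\quad x\in\mathcal{I}_2^J,$$ $$\mathcal{F}(u_1,u_2)(x)=\tfrac12\int_{\mathcal{I}_2^J}[u_2(x)-u_2(y)](\gamma_{\delta_1}(x,y)-\gamma_{\delta_2}(x,y))\,dy,\quad x\in\mathcal{I}_1^J.$$ (Conditions on and norms of $\mathcal{F}$ on $\Gamma$ are understood on $\mathcal{I}_1^J\cup\mathcal{I}_2^J=\Gamma\setminus\{\alpha\}$.) Spaces and norms. $C_b(S)$ is the space of bounded continuous functions on $S$, and $C_b^m(S)$ the space of functions whose derivatives of order $0,\dots,m$ all lie in $C_b(S)$. $\|w\|_{\infty,S}=\sup_{x\in S}|w(x)|$; $\|u\|_{\infty,\Omega}=\max_{i}\|u_i\|_{\infty,\Omega_i}$, $\|u\|_{\infty,\mathcal{I}^D}=\max_i\|u_i\|_{\infty,\mathcal{I}_i^D}$, $\|\mathcal{L}u\|_{\infty,\Omega}=\max_i\|\mathcal{L}_iu_i\|_{\infty,\Omega_i}$. *)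

(* Defs.v *)
From HB Require Import structures.
From mathcomp Require Import all_boot all_order all_algebra.
From mathcomp Require Import all_classical all_reals all_analysis.

Set Implicit Arguments.
Unset Strict Implicit.
Unset Printing Implicit Defensive.

Import Order.TTheory GRing.Theory Num.Theory.
Import numFieldNormedType.Exports.

Local Open Scope classical_set_scope.
Local Open Scope ring_scope.

Section Spaces.
Context {R : realType}.
Implicit Types (S : set R) (u : R -> R).

Definition cont_on S u : Prop := {within S, continuous u}.

Definition cb_on S u : Prop := cont_on S u /\ [bounded u x | x in S].

(* [derive1n k u] is a two-sided derivative, so this is meant for open [S], where
   it depends only on the values of [u] on [S]. *)
Definition cb_smooth_on (m : nat) S u : Prop :=
  (forall k x, (k < m)%N -> S x -> derivable (derive1n k u) x 1) /\
  (forall k, (k <= m)%N -> cb_on S (derive1n k u)).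

(* Extended-real valued, so that an unbounded function has norm +oo. *)
Definition sup_norm S u : \bar R := ereal_sup [set (`|u x|)%:E | x in S].

End Spaces.

Section Kernels.
Context {R : realType}.
Implicit Types (gamma : R -> R) (delta : R).

Definition sigma gamma : R :=
  2^-1 * \int[lebesgue_measure]_(s in `[(-1), 1]) (s ^+ 2 * gamma s).

(* Only vanishing for |s| >= 1 is required: the closed support may be all of
   [-1, 1]. *)
Record is_kernel gamma : Prop := IsKernel {
  kernel_ge0 : forall s, 0 <= gamma s ;
  kernel_even : forall s, gamma (- s) = gamma s ;
  kernel_locint : locally_integrable setT gamma ;
  kernel_supp : forall s, 1 <= `|s| -> gamma s = 0 ;
  kernel_sigma_gt0 : 0 < sigma gamma }.

Definition rescaled gamma delta (x y : R) : R :=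
  delta ^- 3 * gamma ((x - y) / delta).

End Kernels.

Record geometry (R : realType) := Geometry {
  ga : R ; galpha : R ; gb : R ; gdelta1 : R ; gdelta2 : R }.

Section Problem.
Context {R : realType}.
Variable G : geometry R.

Let a := ga G.
Let alpha := galpha G.
Let b := gb G.
Let d1 := gdelta1 G.
Let d2 := gdelta2 G.

Definition Omega1 : set R := `]a, alpha[.
Definition Omega2 : set R := `]alpha, b[.

Definition I1D : set R := `]a - d1, a[.
Definition I2D : set R := `]b, b + d2[.
Definition I1J : set R := `]alpha, alpha + d1[.
Definition I2J : set R := `]alpha - d2, alpha[.

Definition Gamma : set R := `]alpha - d2, alpha + d1[.
Definition Omega2J : set R := `]alpha + d1, alpha + d2[.

(* The unions of adjacent open intervals below include the common endpoints:
   Omega_i with both parts of I_i, then Omega_i with I_i^D only. *)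
Definition Omega1_I1 : set R := `]a - d1, alpha + d1[.
Definition Omega2_I2 : set R := `]alpha - d2, b + d2[.
Definition Omega1_I1D : set R := `]a - d1, alpha[.
Definition Omega2_I2D : set R := `]alpha, b + d2[.

Record admissible : Prop := Admissible {
  adm_alpha : a < alpha < b ;
  adm_delta : 0 < d1 <= d2 ;
  adm_I2J : I2J `<=` Omega1 ;
  adm_I1J : I1J `<=` Omega2 }.

Variables gamma1 gamma2 : R -> R.

Let k1 := rescaled gamma1 d1.
Let k2 := rescaled gamma2 d2.

Definition L1 (u1 : R -> R) (x : R) : R :=
  \int[lebesgue_measure]_(y in Omega1_I1) ((u1 x - u1 y) * k1 x y).

Definition L2 (u2 : R -> R) (x : R) : R :=
  \int[lebesgue_measure]_(y in Omega2_I2) ((u2 x - u2 y) * k2 x y).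

(* Junk value 0 outside I1J `|` I2J. *)
Definition flux (u1 u2 : R -> R) (x : R) : R :=
  if x \in I2J then
    \int[lebesgue_measure]_(y in Omega2J) ((u2 x - u2 y) * k2 x y) +
    2^-1 * \int[lebesgue_measure]_(y in I1J)
             ((u1 x - u1 y) * (k2 x y - k1 x y))
  else if x \in I1J then
    2^-1 * \int[lebesgue_measure]_(y in I2J)
             ((u2 x - u2 y) * (k1 x y - k2 x y))
  else 0.

Definition norm_Omega (u1 u2 : R -> R) : \bar R :=
  maxe (sup_norm Omega1 u1) (sup_norm Omega2 u2).

Definition norm_ID (u1 u2 : R -> R) : \bar R :=
  maxe (sup_norm I1D u1) (sup_norm I2D u2).

Definition norm_flux (u1 u2 : R -> R) : \bar R :=
  sup_norm (I1J `|` I2J) (flux u1 u2).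

End Problem.

(* Main.v *)
(* The barrier q(x) = (x - a)^2 satisfies L_i q = -2 sigma_i exactly, whatever
   delta_i is, because the kernels are even and q is quadratic. Hence u + t q is
   a strict subsolution on both subdomains once 2 t sigma_i > ||L u||, and
   t q <= 4 |Omega|^2 t on the whole domain since delta_2 <= |Omega|.
   A strict subsolution v (L_i v <= -e) with v <= N satisfies
   (v(x) - N) int gamma_{delta_i} <= L_i v(x) <= -e, so that
   v <= N - e / int gamma_{delta_i} inside: the supremum can only come from I^D. The equations are not imposed at
   a, alpha, b, where continuity of v suffices. Applying this to u and -u bounds
   ||u|| by ||u||_{I^D} + C ||L u||; the flux term is then only discarded. *)
Require Import Defs.
From HB Require Import structures.
From mathcomp Require Import all_boot all_order all_algebra.
From mathcomp Require Import all_classical all_reals all_analysis.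
From mathcomp Require Import measurable_realfun ring lra.

Set Implicit Arguments.
Unset Strict Implicit.
Unset Printing Implicit Defensive.

Import Order.TTheory GRing.Theory Num.Theory.
Import numFieldNormedType.Exports.

Local Open Scope classical_set_scope.
Local Open Scope ring_scope.

(** * Affine change of variables [s = (x - y) / d] in Lebesgue integrals *)

Lemma lebesgue_measure_affine {R : realType} (x d : R) (A : set R) : 0 < d ->
  measurable A ->
  pushforward lebesgue_measure ((fun y => (x - y) / d) : _ -> measurableTypeR R) A
  = (d%:E * lebesgue_measure A)%E.
Proof.
move=> d0 mA.
have di0 : 0 <= d^-1 by rewrite invr_ge0 ltW.
have mf : measurable_fun setT ((fun y : measurableTypeR R => (x - y) / d) : _ -> measurableTypeR R).
  by apply: measurable_funM => //; apply: measurable_funB.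
pose mf1 := isMeasurableFun.Build _ _ _ _ _ mf.
pose F : {mfun _ >-> _} :=
  HB.pack ((fun y => (x - y) / d) : measurableTypeR R -> measurableTypeR R) mf1.
(* By uniqueness of Lebesgue measure, it suffices that [d^-1] times the pushforward gives each
   interval []p, q]] its length. The map reverses orientation, so the preimage is closed on the left
   and open on the right. *)
rewrite (@lebesgue_measure_unique R (mscale (NngNum di0) (pushforward lebesgue_measure F))) //=.
  by rewrite /mscale /= muleA -EFinM mulfV ?gt_eqF// mul1e.
move=> _ [[p q]] _ <-; rewrite /mscale /= /pushforward /=.
have -> : (fun y => (x - y) / d) @^-1` `]p, q] = `[x - d * q, x - d * p[%classic.
  apply/seteqP; split => y /=;
    rewrite !in_itv /= ltr_pdivlMr // ler_pdivrMr // => /andP[h1 h2];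
    by apply/andP; split; lra.
rewrite !lebesgue_measure_itv /= !lte_fin ltrD2l ltrN2 ltr_pM2l //.
case: ifPn => _; last by rewrite mule0.
rewrite -!EFinB -EFinM; congr EFin.
have dn : d != 0 by rewrite gt_eqF.
by field.
Qed.

Section Affine.
Context {R : realType}.
Local Notation mu := (@lebesgue_measure R).

Lemma measurable_affine (x d : R) : measurable_fun setT (fun y : R => (x - y) / d).
Proof. by apply: measurable_funM => //; apply: measurable_funB. Qed.

Lemma ge0_integral_affine (x d : R) (f : R -> \bar R) : 0 < d ->
  measurable_fun setT f -> (forall s, 0 <= f s)%E ->
  (\int[mu]_y f ((x - y) / d)%R = d%:E * \int[mu]_s f s)%E.
Proof.
move=> d0 mf f0.
have dge0 : 0 <= d by exact: ltW.
rewrite -(@ge0_integral_mscale _ _ _ mu setT measurableT (NngNum dge0)) //.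
transitivity (\int[pushforward mu
    ((fun y => (x - y) / d)%R : _ -> measurableTypeR R)]_s f s)%E.
  by rewrite ge0_integral_pushforward //; exact: measurable_affine.
apply: eq_measure_integral => [|mf' A mA _]; first exact: measurable_affine.
by rewrite [LHS](lebesgue_measure_affine _ d0 mA).
Qed.

Lemma integrable_affine (x d : R) (f : R -> R) : 0 < d ->
  mu.-integrable setT (EFin \o f) ->
  mu.-integrable setT (fun y => (f ((x - y) / d))%:E).
Proof.
move=> d0 /integrableP[mf fi]; apply/integrableP; split.
  exact: (measurableT_comp mf (measurable_affine x d)).
rewrite (@ge0_integral_affine x d (fun s => `|(f s)%:E|%E)) //.
  by rewrite lte_mul_pinfty// lee_fin ltW.
exact: measurableT_comp.
Qed.

(** Positive and negative parts commute with the substitution, so the nonnegative case applies to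
    each; integrability makes both integrals finite and lets [fine] distribute. *)
Lemma Rintegral_affine (x d : R) (f : R -> R) : 0 < d ->
  mu.-integrable setT (EFin \o f) ->
  \int[mu]_y f ((x - y) / d) = d * \int[mu]_s f s.
Proof.
move=> d0 fi.
have mf : measurable_fun setT (EFin \o f) by exact: measurable_int fi.
have fineE (h : R -> R) : mu.-integrable setT (EFin \o h) -> \int[mu]_s h s =
    fine (\int[mu]_s (EFin \o h)^\+%E s) - fine (\int[mu]_s (EFin \o h)^\-%E s).
  move=> hi; rewrite /Rintegral integralE fineB //.
    exact: integrable_pos_fin_num hi.
  exact: integrable_neg_fin_num hi.
rewrite fineE; last exact: integrable_affine.
rewrite fineE //.
rewrite -[EFin \o (fun s => f ((x - s) / d))]/((EFin \o f) \o (fun s => (x - s) / d)).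
rewrite funepos_comp funeneg_comp.
rewrite [X in fine X - _](@ge0_integral_affine x d (EFin \o f)^\+%E) //;
  last exact: measurable_funepos.
rewrite [X in _ - fine X](@ge0_integral_affine x d (EFin \o f)^\-%E) //;
  last exact: measurable_funeneg.
rewrite !fineM ?mulrBr //.
- exact: integrable_neg_fin_num fi.
- exact: integrable_pos_fin_num fi.
Qed.

Lemma Rintegral_odd (f : R -> R) : mu.-integrable setT (EFin \o f) ->
  (forall s, f (- s) = - f s) -> \int[mu]_s f s = 0.
Proof.
(* With [x = 0] and [d = 1] the substitution is the reflection [s -> - s], under which the integral
   equals its own opposite. *)
move=> fi fN; have := Rintegral_affine 0 ltr01 fi; rewrite mul1r.
have -> : \int[mu]_s f ((0 - s) / 1) = \int[mu]_s (-1 * f s).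
  by apply: eq_Rintegral => s _; rewrite sub0r divr1 fN mulN1r.
rewrite RintegralZl//; lra.
Qed.

End Affine.

(** * Moments of the kernels and the nonlocal operator on a quadratic *)

Section Kernel.
Context {R : realType}.
Local Notation mu := (@lebesgue_measure R).
Variables (gamma : R -> R) (hgamma : is_kernel gamma).

Lemma kernel_measurable : measurable_fun setT gamma.
Proof. by case: hgamma => _ _ [mg _ _]. Qed.

Lemma kernel_out (s : R) : s \notin `[(-1), 1] -> gamma s = 0.
Proof.
rewrite in_itv /= -ler_norml -ltNge => /ltW; exact: kernel_supp.
Qed.

Lemma kernel_integrable : mu.-integrable setT (EFin \o gamma).
Proof.
apply/integrableP; split.
  by apply/measurable_EFinP; exact: kernel_measurable.
have [_ _ [_ _ gK] _ _] := hgamma.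
have := gK `[(-1), 1]%classic (@subsetT _ _) (@segment_compact _ _ _).
rewrite integral_mkcond; apply: le_lt_trans.
rewrite le_eqVlt; apply/orP; left; apply/eqP; apply: eq_integral => s _.
rewrite patchE; case: ifPn => //=; rewrite notin_setE /= => /negP sN.
by rewrite kernel_out // normr0.
Qed.

(** Dominated by [gamma] itself: where [gamma] can be nonzero, [|s| < 1] and so [|s ^+ n| <= 1]. *)
Lemma moment_integrable n : mu.-integrable setT (fun s => (s ^+ n * gamma s)%:E).
Proof.
apply: le_integrable kernel_integrable => //.
  apply/measurable_EFinP/measurable_funM; last exact: kernel_measurable.
  exact: measurable_funX.
move=> s _ /=; rewrite lee_fin normrM normrX.
have [s1|s1] := ltP `|s| 1.
  by rewrite ler_piMl // exprn_ile1 // ltW.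
by rewrite (kernel_supp hgamma) // normr0 mulr0.
Qed.

Lemma second_moment : \int[mu]_s (s ^+ 2 * gamma s) = 2 * sigma gamma.
Proof.
rewrite /sigma mulrA mulfV // mul1r [RHS]Rintegral_mkcond.
apply: eq_Rintegral => s _; rewrite patchE; case: ifPn => //.
rewrite notin_setE /= => /negP sN.
by rewrite kernel_out // mulr0.
Qed.

Lemma first_moment : \int[mu]_s (s ^+ 1 * gamma s) = 0.
Proof.
apply: Rintegral_odd; first exact: moment_integrable.
by move=> s; rewrite !expr1 (kernel_even hgamma) mulNr.
Qed.

Variables (d : R) (d0 : 0 < d).

Lemma rescaled_ge0 (x y : R) : 0 <= rescaled gamma d x y.
Proof.
by rewrite mulr_ge0 ?(kernel_ge0 hgamma) // invr_ge0 exprn_ge0 // ltW.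
Qed.

Lemma rescaled_integrable (x : R) :
  mu.-integrable setT (fun y => (rescaled gamma d x y)%:E).
Proof.
exact: integrableZl (integrable_affine x d0 kernel_integrable).
Qed.

Lemma rescaled_mass (x : R) :
  \int[mu]_y rescaled gamma d x y = d ^- 2 * \int[mu]_s gamma s.
Proof.
rewrite RintegralZl //; last exact: integrable_affine kernel_integrable.
rewrite Rintegral_affine //; last exact: kernel_integrable.
have dn : d != 0 by rewrite gt_eqF.
by field.
Qed.

(** With [y = x - d s], the difference of squares is [2 (x - c) d s - d^2 s^2]. The linear term dies
    by evenness, and the factors [d^-3], [d] (Jacobian) and [d^2] cancel, so no horizon is left in
    the value. *)
Lemma rescaled_quadratic (D : set R) (c x : R) : measurable D ->
  (forall y, `|x - y| < d -> D y) ->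
  \int[mu]_(y in D) (((x - c) ^+ 2 - (y - c) ^+ 2) * rescaled gamma d x y)
  = - (2 * sigma gamma).
Proof.
move=> mD xD; have dn : d != 0 by rewrite gt_eqF.
pose h s := d ^- 3 * ((2 * (x - c) * d) * (s ^+ 1 * gamma s) +
                      (- d ^+ 2) * (s ^+ 2 * gamma s)).
have hi1 := moment_integrable 1.
have hi2 := moment_integrable 2.
have hi : mu.-integrable setT (fun s => ((2 * (x - c) * d) * (s ^+ 1 * gamma s) +
                      (- d ^+ 2) * (s ^+ 2 * gamma s))%:E).
  exact: (integrableD measurableT (integrableZl measurableT (2 * (x - c) * d) hi1)
    (integrableZl measurableT (- d ^+ 2) hi2)).
transitivity (\int[mu]_y h ((x - y) / d)).
  rewrite Rintegral_mkcond; apply: eq_Rintegral => y _.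
  rewrite patchE; case: ifPn => yD; first by rewrite /h /rescaled; field.
  (* A point outside [D] is at distance at least [d] from [x], where the kernel vanishes; the
     integral therefore extends to the whole line. *)
  rewrite /h (kernel_supp hgamma) ?mulr0 ?addr0 ?mulr0 //.
  rewrite normrM normfV (gtr0_norm d0) ler_pdivlMr // mul1r leNgt.
  by apply/negP => /xD /mem_set yD'; rewrite yD' in yD.
rewrite Rintegral_affine //; last exact: (integrableZl measurableT _ hi).
rewrite RintegralZl // RintegralD //; last 2 first.
- exact: (integrableZl measurableT _ hi1).
- exact: (integrableZl measurableT _ hi2).
rewrite !RintegralZl // first_moment second_moment.
by field.
Qed.

Lemma nonlocal_integrable (D : set R) (c x M : R) (f : R -> R) : measurable D ->
  measurable_fun D f -> (forall y, D y -> `|f y| <= M) ->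
  mu.-integrable D (fun y => ((c - f y) * rescaled gamma d x y)%:E).
Proof.
move=> mD mf fM.
have ki : mu.-integrable D (fun y => (rescaled gamma d x y)%:E).
  exact: integrableS (rescaled_integrable x).
have mh : measurable_fun D (fun y => c - f y) by exact: measurable_funB.
have bh : [bounded c - f y | y in D].
  exists (`|c| + M); split; first by rewrite num_real.
  move=> z /ltW zM y Dy /=; apply: le_trans zM.
  by apply: le_trans (ler_normB _ _) _; rewrite lerD2l fM.
exact: (@integrableMr _ _ _ mu D mD (fun y => c - f y) _ mh bh ki).
Qed.

(** Replacing [f y] by its upper bound [N] lowers the integrand to [(f x - N)] times the kernel.
    Since [f x - N <= 0], enlarging the kernel mass from [D] to the whole line lowers it further. *)
Lemma nonlocal_ge (D : set R) (x M N : R) (f : R -> R) : measurable D ->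
  measurable_fun D f -> (forall y, D y -> `|f y| <= M) ->
  (forall y, D y -> f y <= N) -> f x <= N ->
  (f x - N) * (d ^- 2 * \int[mu]_s gamma s) <=
  \int[mu]_(y in D) ((f x - f y) * rescaled gamma d x y).
Proof.
move=> mD mf fM fN fxN.
have ki : mu.-integrable D (fun y => (rescaled gamma d x y)%:E).
  exact: integrableS (rescaled_integrable x).
apply: (@le_trans _ _ (\int[mu]_(y in D) ((f x - N) * rescaled gamma d x y))).
  rewrite RintegralZl // ler_wnM2l ?subr_le0 // -(rescaled_mass x) Rintegral_mkcond.
  apply: le_Rintegral => //.
  - by rewrite -restrict_EFin; exact: (iffLR (@integrable_mkcond _ _ _ mu D
      (EFin \o rescaled gamma d x) mD) ki).
  - exact: rescaled_integrable.
  - by move=> y _; rewrite patchE; case: ifPn => // _; exact: rescaled_ge0.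
apply: le_Rintegral => //.
- exact: (@integrableZl _ _ _ mu D mD (f x - N) _ ki).
- exact: nonlocal_integrable fM.
- by move=> y Dy; rewrite ler_wpM2r ?rescaled_ge0 // lerD2l lerN2 fN.
Qed.

Lemma nonlocal_barrier (D : set R) (c t x M N : R) (f : R -> R) : measurable D ->
  (forall y, `|x - y| < d -> D y) ->
  measurable_fun D f -> (forall y, D y -> `|f y| <= M) ->
  (forall y, D y -> `|(y - c) ^+ 2| <= N) ->
  let v y := f y + t * (y - c) ^+ 2 in
  \int[mu]_(y in D) ((v x - v y) * rescaled gamma d x y) =
  \int[mu]_(y in D) ((f x - f y) * rescaled gamma d x y) - t * (2 * sigma gamma).
Proof.
move=> mD xD mf fM qN v; rewrite -mulrN -(rescaled_quadratic c mD xD).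
have fi := nonlocal_integrable (f x) x mD mf fM.
have mq : measurable_fun D (fun y => (y - c) ^+ 2).
  by apply: measurable_funX; exact: measurable_funB.
have qi := nonlocal_integrable ((x - c) ^+ 2) x mD mq qN.
rewrite -RintegralZl // -RintegralD //.
  by apply: eq_Rintegral => y _; rewrite /v; ring.
exact: (@integrableZl _ _ _ mu D mD t _ qi).
Qed.

End Kernel.

(** * Lowering an upper bound by a fixed step, and bounds at endpoints *)

Lemma sup_descent {R : realType} (V : set R) (A M theta : R) : V !=set0 ->
  0 < theta -> ubound V M ->
  (forall N, ubound V N -> ubound V (Num.max A (N - theta))) -> ubound V A.
Proof.
move=> V0 t0 VM step.
have Vs : ubound V (sup V) by apply: ub_le_sup; exists M.
(* At [N = sup V] the step yields either the bound [A] or the bound [sup V - theta], and the latter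
   contradicts minimality of the supremum. *)
have := step _ Vs; rewrite maxEle; case: ifP => // _ Vt.
have : sup V <= sup V - theta by apply: ge_sup.
lra.
Qed.

Lemma left_limit_le {R : realType} (f : R -> R) (l r m p N : R) :
  cont_on `]l, r[ f -> l < p < r -> m < p ->
  (forall y, m < y < p -> f y <= N) -> f p <= N.
Proof.
move=> cf lpr mp fN.
have cfp : f y @[y --> p] --> f p.
  move: cf; rewrite /cont_on continuous_open_subspace; last exact: interval_open.
  by apply; rewrite inE /= in_itv.
rewrite leNgt; apply/negP => Np.
near p^'- => y.
have : N < f y.
  by near: y; exact: (cvgr_gt _ (cvg_at_left_filter cfp)).
rewrite ltNge fN //; apply/andP; split; last by near: y; exact: nbhs_left_lt.
by near: y; exact: nbhs_left_gt.
Unshelve. all: by end_near. Qed.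

(** * Comparison principle for the coupled pair and one-sided estimate with the barrier *)

Section Comparison.
Context {R : realType}.
Local Notation mu := (@lebesgue_measure R).
Variables (G : geometry R) (hG : admissible G).

(** If the first inequality failed, [a] would lie in [I2J], hence in the open interval [Omega1] of
    which it is an endpoint; likewise [b] with [I1J] and [Omega2]. *)
Lemma admissible_bounds : [/\ ga G <= galpha G - gdelta2 G, galpha G + gdelta1 G <= gb G,
  ga G < galpha G < gb G & 0 < gdelta1 G <= gdelta2 G].
Proof.
case: hG => hab hd hJ2 hJ1; split => //; rewrite leNgt; apply/negP => h.
  have : I2J G (ga G) by rewrite /I2J /= in_itv /=; lra.
  by move/hJ2; rewrite /Omega1 /= in_itv /= ltxx.
have : I1J G (gb G) by rewrite /I1J /= in_itv /=; lra.
by move/hJ1; rewrite /Omega2 /= in_itv /= ltxx andbF.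
Qed.

(** Three open pieces cover the domain up to [a] and [alpha]: on the part beyond [alpha] the
    functions agree and [u2] is controlled in [Omega2]; at the two points the bound passes to the
    left limit. *)
Lemma ub_Omega1_I1 (N : R) (u1 u2 : R -> R) :
  cont_on (Omega1_I1 G) u1 -> (forall x, Gamma G x -> u1 x = u2 x) ->
  (forall x, I1D G x -> u1 x <= N) -> (forall x, Omega1 G x -> u1 x <= N) ->
  (forall x, Omega2 G x -> u2 x <= N) ->
  forall x, Omega1_I1 G x -> u1 x <= N.
Proof.
have [h1 h2 h3 h4] := admissible_bounds.
rewrite /Gamma /I1D /Omega1 /Omega2 /Omega1_I1 => c1 E uD u1N u2N x.
rewrite /= in_itv /= => xI.
have [xa|xa|->] := ltgtP x (ga G); last first.
- apply: (left_limit_le (m := ga G - gdelta1 G) c1); [lra..|].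
  by move=> y hy; apply: uD; rewrite /= in_itv.
- have [xm|xm|->] := ltgtP x (galpha G); last first.
  + apply: (left_limit_le (m := ga G) c1); [lra..|].
    by move=> y hy; apply: u1N; rewrite /= in_itv.
  + by rewrite E; [apply: u2N|]; rewrite /= in_itv /=; lra.
  + by apply: u1N; rewrite /= in_itv /=; lra.
- by apply: uD; rewrite /= in_itv /=; lra.
Qed.

Lemma ub_Omega2_I2 (N : R) (u1 u2 : R -> R) :
  cont_on (Omega2_I2 G) u2 -> (forall x, Gamma G x -> u1 x = u2 x) ->
  (forall x, Omega1 G x -> u1 x <= N) -> (forall x, Omega2 G x -> u2 x <= N) ->
  (forall x, I2D G x -> u2 x <= N) ->
  forall x, Omega2_I2 G x -> u2 x <= N.
Proof.
have [h1 h2 h3 h4] := admissible_bounds.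
rewrite /Gamma /I2D /Omega1 /Omega2 /Omega2_I2 => c2 E u1N u2N uD x.
rewrite /= in_itv /= => xI.
have [xm|xm|->] := ltgtP x (galpha G); last first.
- apply: (left_limit_le (m := galpha G - gdelta2 G) c2); [lra..|].
  move=> y hy; rewrite -E; last by rewrite /= in_itv /=; lra.
  by apply: u1N; rewrite /= in_itv /=; lra.
- have [xb|xb|->] := ltgtP x (gb G); last first.
  + apply: (left_limit_le (m := galpha G) c2); [lra..|].
    by move=> y hy; apply: u2N; rewrite /= in_itv.
  + by apply: uD; rewrite /= in_itv /=; lra.
  + by apply: u2N; rewrite /= in_itv /=; lra.
- by rewrite -E; [apply: u1N|]; rewrite /= in_itv /=; lra.
Qed.

Lemma ball_Omega1_I1 x y : Omega1 G x -> `|x - y| < gdelta1 G -> Omega1_I1 G y.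
Proof.
rewrite /Omega1 /Omega1_I1 /= !in_itv /= => hx; rewrite ltr_norml => hy; lra.
Qed.

Lemma ball_Omega2_I2 x y : Omega2 G x -> `|x - y| < gdelta2 G -> Omega2_I2 G y.
Proof.
rewrite /Omega2 /Omega2_I2 /= !in_itv /= => hx; rewrite ltr_norml => hy; lra.
Qed.

Lemma cont_on_measurable (l r : R) (f : R -> R) :
  cont_on `]l, r[ f -> measurable_fun `]l, r[ f.
Proof. exact: subspace_continuous_measurable_fun. Qed.

Variables (gamma1 gamma2 : R -> R) (hg1 : is_kernel gamma1) (hg2 : is_kernel gamma2).

Section Pair.
Variables (u1 u2 : R -> R) (M A : R).
Hypotheses (c1 : cont_on (Omega1_I1 G) u1) (c2 : cont_on (Omega2_I2 G) u2)
  (E : forall x, Gamma G x -> u1 x = u2 x)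
  (b1 : forall x, Omega1_I1 G x -> `|u1 x| <= M)
  (b2 : forall x, Omega2_I2 G x -> `|u2 x| <= M)
  (uD1 : forall x, I1D G x -> u1 x <= A)
  (uD2 : forall x, I2D G x -> u2 x <= A).

Lemma comparison (e : R) : 0 < e ->
  (forall x, Omega1 G x -> L1 G gamma1 u1 x <= - e) ->
  (forall x, Omega2 G x -> L2 G gamma2 u2 x <= - e) ->
  (forall x, Omega1 G x -> u1 x <= A) /\ (forall x, Omega2 G x -> u2 x <= A).
Proof.
move=> e0 l1 l2; have [h1 h2 h3 h4] := admissible_bounds.
have d1 : 0 < gdelta1 G by lra.
have d2 : 0 < gdelta2 G by lra.
pose K1 := gdelta1 G ^- 2 * \int[mu]_s gamma1 s.
pose K2 := gdelta2 G ^- 2 * \int[mu]_s gamma2 s.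
have K1p : 0 <= K1.
  apply: mulr_ge0; first by rewrite invr_ge0 exprn_ge0 // ltW.
  by apply: Rintegral_ge0 => s _; exact: kernel_ge0.
have K2p : 0 <= K2.
  apply: mulr_ge0; first by rewrite invr_ge0 exprn_ge0 // ltW.
  by apply: Rintegral_ge0 => s _; exact: kernel_ge0.
(* One denominator serves both kernels, and the [1] keeps it positive. It depends on the horizons,
   which is harmless: the descent only needs some positive step. *)
have K0 : 0 < K1 + K2 + 1 by lra.
(* Pooling the values of both functions into one set couples the subdomains: a bound on [V] passes
   across the overlap and the endpoints to both full domains. *)
pose V := u1 @` (I1D G `|` Omega1 G) `|` u2 @` (Omega2 G `|` I2D G).
have m : Omega1 G ((ga G + galpha G) / 2) by rewrite /Omega1 /= in_itv /=; lra.
have VM : ubound V M.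
  move=> _ [[x xI <-]|[x xI <-]]; apply: le_trans (ler_norm _) _.
    apply: b1; move: xI; rewrite /I1D /Omega1 /Omega1_I1 /= !in_itv /= => -[]; lra.
  apply: b2; move: xI; rewrite /I2D /Omega2 /Omega2_I2 /= !in_itv /= => -[]; lra.
suff VA : ubound V A.
  split=> x hx; apply: VA; first by left; exists x => //; right.
  by right; exists x => //; left.
apply: (@sup_descent _ V A M (e / (K1 + K2 + 1))) => //.
- by exists (u1 ((ga G + galpha G) / 2)); left; eexists; last reflexivity; right.
- by rewrite divr_gt0.
move=> N VN.
have n1 x : Omega1_I1 G x -> u1 x <= N.
  apply: (ub_Omega1_I1 c1 E) => y hy; apply: VN.
  - by left; exists y => //; left.
  - by left; exists y => //; right.
  - by right; exists y => //; left.
have n2 x : Omega2_I2 G x -> u2 x <= N.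
  apply: (ub_Omega2_I2 c2 E) => y hy; apply: VN.
  - by left; exists y => //; right.
  - by right; exists y => //; left.
  - by right; exists y => //; right.
(* From [e <= (N - z) K] and [K < K1 + K2 + 1] follows [e <= (N - z) (K1 + K2 + 1)], a gap that is
   uniform in the point. *)
have drop z K : 0 <= K -> K < K1 + K2 + 1 -> z <= N -> (z - N) * K <= - e ->
    z <= N - e / (K1 + K2 + 1).
  move=> Kp KK zN zK; rewrite lerBrDl -lerBrDr ler_pdivrMr //; nra.
move=> _ [[x [xI|xI] <-]|[x [xI|xI] <-]]; rewrite le_max; apply/orP.
- by left; apply: uD1.
- have xI1 : Omega1_I1 G x by apply: (ball_Omega1_I1 xI); rewrite subrr normr0.
  right; apply: (drop _ K1) => //; [lra|exact: n1|].
  apply: le_trans (l1 _ xI).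
  exact: (nonlocal_ge hg1 d1 (measurable_itv _) (cont_on_measurable c1) b1 n1
    (n1 _ xI1)).
- have xI2 : Omega2_I2 G x by apply: (ball_Omega2_I2 xI); rewrite subrr normr0.
  right; apply: (drop _ K2) => //; [lra|exact: n2|].
  apply: le_trans (l2 _ xI).
  exact: (nonlocal_ge hg2 d2 (measurable_itv _) (cont_on_measurable c2) b2 n2
    (n2 _ xI2)).
- by left; apply: uD2.
Qed.

End Pair.

(** Comparison is applied to [u + t q]. The slack [e > 0] keeps the subsolution strict even when
    [B = 0]; it is sent to zero later. *)
Lemma upper_estimate (u1 u2 : R -> R) (M A B s e : R) :
  cont_on (Omega1_I1 G) u1 -> cont_on (Omega2_I2 G) u2 ->
  (forall x, Gamma G x -> u1 x = u2 x) ->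
  (forall x, Omega1_I1 G x -> `|u1 x| <= M) ->
  (forall x, Omega2_I2 G x -> `|u2 x| <= M) ->
  (forall x, I1D G x -> u1 x <= A) ->
  (forall x, I2D G x -> u2 x <= A) ->
  (forall x, Omega1 G x -> L1 G gamma1 u1 x <= B) ->
  (forall x, Omega2 G x -> L2 G gamma2 u2 x <= B) ->
  0 <= B -> 0 < s -> s <= sigma gamma1 -> s <= sigma gamma2 -> 0 < e ->
  let C := A + 2 * (gb G - ga G) ^+ 2 / s * (B + e) in
  (forall x, Omega1 G x -> u1 x <= C) /\ (forall x, Omega2 G x -> u2 x <= C).
Proof.
move=> c1 c2 E b1 b2 uD1 uD2 l1 l2 B0 s0 s1 s2 e0 C.
have [h1 h2 h3 h4] := admissible_bounds.
have d1 : 0 < gdelta1 G by lra.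
have d2 : 0 < gdelta2 G by lra.
(* Chosen so that [t * 2 sigma_i >= B + e] for both kernels, since [s] lies below both [sigma_i]. *)
pose t := (B + e) / (2 * s).
have t0 : 0 <= t by rewrite divr_ge0 //; lra.
(* Both horizons are at most [b - a], so [|x - a| <= 2 (b - a)] on the extended domains. *)
pose Q := 4 * (gb G - ga G) ^+ 2.
have tQ : t * Q = 2 * (gb G - ga G) ^+ 2 / s * (B + e).
  by rewrite /t /Q; field; rewrite gt_eqF.
have ts : t * (2 * s) = B + e by rewrite /t mulfVK // mulf_neq0 // gt_eqF.
pose q (x : R) := (x - ga G) ^+ 2.
have q0 x : 0 <= q x by exact: sqr_ge0.
have qQ x : ga G - gdelta2 G < x -> x < gb G + gdelta2 G -> q x <= Q.
  rewrite /q /Q => xl xr; nra.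
have q1 y : Omega1_I1 G y -> `|q y| <= Q.
  by rewrite ger0_norm // /Omega1_I1 /= in_itv /= => hy; apply: qQ; lra.
have q2 y : Omega2_I2 G y -> `|q y| <= Q.
  by rewrite ger0_norm // /Omega2_I2 /= in_itv /= => hy; apply: qQ; lra.
have cv (l r : R) f : cont_on `]l, r[ f -> cont_on `]l, r[ (fun x => f x + t * q x).
  move=> cf; have cq : cont_on `]l, r[ (fun x => t * q x).
    apply: continuous_subspaceT => y.
    have cB : (z - ga G) @[z --> y] --> y - ga G.
      by apply: cvgB; [exact: cvg_id|exact: cvg_cst].
    by apply: cvgM; [exact: cvg_cst|exact: (cvgM cB cB)].
  by move=> x; exact: cvgD (cf x) (cq x).
have bv f y : `|f| <= M -> `|q y| <= Q -> `|f + t * q y| <= M + t * Q.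
  move=> fM yQ; apply: le_trans (ler_normD _ _) (lerD fM _).
  by rewrite normrM (ger0_norm t0) ler_wpM2l.
have [v1 v2] : (forall x, Omega1 G x -> u1 x + t * q x <= C) /\
    (forall x, Omega2 G x -> u2 x + t * q x <= C).
  apply: (@comparison _ _ (M + t * Q) _ _ _ _ _ _ _ _ e e0).
  - exact: cv.
  - exact: cv.
  - by move=> x xG; rewrite E.
  - by move=> x xI; apply: bv; [exact: b1|exact: q1].
  - by move=> x xI; apply: bv; [exact: b2|exact: q2].
  - move=> x xI; rewrite /C -tQ lerD ?uD1 // ler_wpM2l //.
    by move: xI; rewrite /I1D /= in_itv /= => hx; apply: qQ; lra.
  - move=> x xI; rewrite /C -tQ lerD ?uD2 // ler_wpM2l //.
    by move: xI; rewrite /I2D /= in_itv /= => hx; apply: qQ; lra.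
  (* The operator on [u + t q] is at most [B - 2 t sigma_i <= B - (B + e) = - e]. *)
  - move=> x xI; rewrite /L1 (nonlocal_barrier hg1 d1 t (measurable_itv _)
      (fun y => @ball_Omega1_I1 x y xI) (cont_on_measurable c1) b1 q1).
    by have := l1 _ xI; rewrite /L1; nra.
  - move=> x xI; rewrite /L2 (nonlocal_barrier hg2 d2 t (measurable_itv _)
      (fun y => @ball_Omega2_I2 x y xI) (cont_on_measurable c2) b2 q2).
    by have := l2 _ xI; rewrite /L2; nra.
split=> x hx; [apply: le_trans (v1 x hx)|apply: le_trans (v2 x hx)];
  by rewrite lerDl mulr_ge0.
Qed.

End Comparison.

(** * Sup norms, boundedness of the glued pair and the two-sided estimate *)

Section Norms.
Context {R : realType}.
Implicit Types (S : set R) (u : R -> R).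

Lemma sup_norm_ge S u x : S x -> ((`|u x|)%:E <= sup_norm S u)%E.
Proof. by move=> Sx; apply: ereal_sup_ubound; exists x. Qed.

Lemma sup_norm_le S u (c : R) :
  (forall x, S x -> `|u x| <= c) -> (sup_norm S u <= c%:E)%E.
Proof. by move=> uc; apply: ge_ereal_sup => _ [x Sx <-]; rewrite lee_fin uc. Qed.

Lemma sup_norm_ge0 S u : S !=set0 -> (0 <= sup_norm S u)%E.
Proof. by move=> [x Sx]; apply: le_trans (sup_norm_ge u Sx); rewrite lee_fin. Qed.

Lemma cb_smooth_bounded m S u : cb_smooth_on m S u ->
  exists M, forall x, S x -> `|u x| <= M.
Proof.
move=> [_ /(_ 0%N (leq0n _)) [_ [M [_ uM]]]]; exists (M + 1) => x Sx.
by apply: (uM (M + 1)) => //; rewrite ltrDl.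
Qed.

End Norms.

Section Estimate.
Context {R : realType}.
Local Notation mu := (@lebesgue_measure R).
Variables (G : geometry R) (hG : admissible G).

(** The [C_b^2] hypotheses bound each function only on its own side of [alpha]. Agreement on [Gamma]
    and continuity carry the bounds across, by the one-sided lemmas applied to [u] and to [- u]. *)
Lemma glued_bounded (u1 u2 : R -> R) :
  cont_on (Omega1_I1 G) u1 -> cont_on (Omega2_I2 G) u2 ->
  (forall x, Gamma G x -> u1 x = u2 x) ->
  cb_smooth_on 2 (Omega1_I1D G) u1 -> cb_smooth_on 2 (Omega2_I2D G) u2 ->
  exists M, (forall x, Omega1_I1 G x -> `|u1 x| <= M) /\
            (forall x, Omega2_I2 G x -> `|u2 x| <= M).
Proof.
move=> c1 c2 E /cb_smooth_bounded [M1 uM1] /cb_smooth_bounded [M2 uM2].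
have [h1 h2 h3 h4] := admissible_bounds hG.
pose M := Num.max M1 M2.
have nb (f : R -> R) (S : set R) : cont_on S f -> cont_on S (fun x => - f x).
  by move=> cf x; apply: cvgN; exact: cf.
have k1 x : I1D G x \/ Omega1 G x -> `|u1 x| <= M.
  move=> hx; rewrite le_max uM1 //; move: hx.
  rewrite /I1D /Omega1 /Omega1_I1D /= !in_itv /= => -[]; lra.
have k2 x : I2D G x \/ Omega2 G x -> `|u2 x| <= M.
  move=> hx; rewrite le_max uM2 ?orbT //; move: hx.
  rewrite /I2D /Omega2 /Omega2_I2D /= !in_itv /= => -[]; lra.
have p1 x : I1D G x \/ Omega1 G x -> u1 x <= M /\ - u1 x <= M.
  by move=> /k1; rewrite ler_norml => /andP[? ?]; split=> //; lra.
have p2 x : I2D G x \/ Omega2 G x -> u2 x <= M /\ - u2 x <= M.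
  by move=> /k2; rewrite ler_norml => /andP[? ?]; split=> //; lra.
have EN x : Gamma G x -> - u1 x = - u2 x by move=> /E ->.
exists M; split=> x hx; rewrite ler_norml; apply/andP; split; rewrite 1?lerNl.
- apply: (ub_Omega1_I1 hG (nb _ _ c1) EN) hx => y hy.
  + by apply: (p1 y _).2; left.
  + by apply: (p1 y _).2; right.
  + by apply: (p2 y _).2; right.
- apply: (ub_Omega1_I1 hG c1 E) hx => y hy.
  + by apply: (p1 y _).1; left.
  + by apply: (p1 y _).1; right.
  + by apply: (p2 y _).1; right.
- apply: (ub_Omega2_I2 hG (nb _ _ c2) EN) hx => y hy.
  + by apply: (p1 y _).2; right.
  + by apply: (p2 y _).2; right.
  + by apply: (p2 y _).2; left.
- apply: (ub_Omega2_I2 hG c2 E) hx => y hy.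
  + by apply: (p1 y _).1; right.
  + by apply: (p2 y _).1; right.
  + by apply: (p2 y _).1; left.
Qed.

Lemma nonlocalN (gamma : R -> R) (d : R) (D : set R) (f : R -> R) (x M : R) :
  is_kernel gamma -> 0 < d -> measurable D -> measurable_fun D f ->
  (forall y, D y -> `|f y| <= M) ->
  \int[mu]_(y in D) ((- f x - - f y) * rescaled gamma d x y) =
  - \int[mu]_(y in D) ((f x - f y) * rescaled gamma d x y).
Proof.
move=> hg d0 mD mf fM.
transitivity (\int[mu]_(y in D) (-1 * ((f x - f y) * rescaled gamma d x y))).
  by apply: eq_Rintegral => y _; ring.
by rewrite RintegralZl ?mulN1r //; exact: nonlocal_integrable fM.
Qed.

(** The one-sided estimate is applied to [u] and to [- u], whose nonlocal terms are both at most
    [B], and then the slack [e] tends to zero. *)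
Lemma two_sided_estimate (gamma1 gamma2 : R -> R) (u1 u2 : R -> R) (A B s : R) :
  is_kernel gamma1 -> is_kernel gamma2 ->
  cont_on (Omega1_I1 G) u1 -> cont_on (Omega2_I2 G) u2 ->
  (forall x, Gamma G x -> u1 x = u2 x) ->
  cb_smooth_on 2 (Omega1_I1D G) u1 -> cb_smooth_on 2 (Omega2_I2D G) u2 ->
  (forall x, I1D G x -> `|u1 x| <= A) ->
  (forall x, I2D G x -> `|u2 x| <= A) ->
  (forall x, Omega1 G x -> `|L1 G gamma1 u1 x| <= B) ->
  (forall x, Omega2 G x -> `|L2 G gamma2 u2 x| <= B) ->
  0 <= B -> 0 < s -> s <= sigma gamma1 -> s <= sigma gamma2 ->
  let C := A + 2 * (gb G - ga G) ^+ 2 / s * B in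
  (forall x, Omega1 G x -> `|u1 x| <= C) /\ (forall x, Omega2 G x -> `|u2 x| <= C).
Proof.
move=> hg1 hg2 c1 c2 E s1 s2 uD1 uD2 l1 l2 B0 s0 ss1 ss2 C.
have [M [b1 b2]] := glued_bounded c1 c2 E s1 s2.
have [h1 h2 h3 h4] := admissible_bounds hG.
have d1 : 0 < gdelta1 G by lra.
have d2 : 0 < gdelta2 G by lra.
pose k := 2 * (gb G - ga G) ^+ 2 / s.
have k0 : 0 < k by rewrite divr_gt0 // mulr_gt0 // exprn_gt0 //; lra.
have up (z c : R) : `|z| <= c -> z <= c /\ - z <= c.
  by rewrite ler_norml => /andP[? ?]; split=> //; lra.
have nb (f : R -> R) (S : set R) : cont_on S f -> cont_on S (fun x => - f x).
  by move=> cf x; apply: cvgN; exact: cf.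
have CE (z : R) : (forall e, 0 < e -> z <= A + k * (B + e)) -> z <= C.
  move=> ze; apply/ler_addgt0Pr => e e0.
  (* A slack of [e / k] inside the product exceeds [C] by exactly [e]. *)
  have := ze (e / k) (divr_gt0 e0 k0).
  by rewrite mulrDr (mulrC k (e / k)) divfK ?gt_eqF // addrA.
have pos e : 0 < e -> (forall x, Omega1 G x -> u1 x <= A + k * (B + e)) /\
    (forall x, Omega2 G x -> u2 x <= A + k * (B + e)).
  move=> e0; apply: (upper_estimate hG hg1 hg2 c1 c2 E b1 b2) => // x hx.
  - by have [] := up _ _ (uD1 x hx).
  - by have [] := up _ _ (uD2 x hx).
  - by have [] := up _ _ (l1 x hx).
  - by have [] := up _ _ (l2 x hx).
have neg e : 0 < e -> (forall x, Omega1 G x -> - u1 x <= A + k * (B + e)) /\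
    (forall x, Omega2 G x -> - u2 x <= A + k * (B + e)).
  move=> e0; apply: (@upper_estimate _ _ hG _ _ hg1 hg2 _ _ M _ _ _ _
    (nb _ _ c1) (nb _ _ c2)) => // x hx.
  - by rewrite E.
  - by rewrite normrN b1.
  - by rewrite normrN b2.
  - by have [] := up _ _ (uD1 x hx).
  - by have [] := up _ _ (uD2 x hx).
  - rewrite /L1 (nonlocalN x hg1 d1 (measurable_itv _) (cont_on_measurable c1) b1).
    by have [] := up _ _ (l1 x hx).
  - rewrite /L2 (nonlocalN x hg2 d2 (measurable_itv _) (cont_on_measurable c2) b2).
    by have [] := up _ _ (l2 x hx).
split=> x hx; rewrite ler_norml; apply/andP; split; rewrite 1?lerNl; apply: CE => e e0.
- exact: (neg e e0).1.
- exact: (pos e e0).1.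
- exact: (neg e e0).2.
- exact: (pos e e0).2.
Qed.

End Estimate.

(** * From pointwise bounds to the inequality between extended-real norms *)

Unset Implicit Arguments.
Set Strict Implicit.
Set Printing Implicit Defensive.

Theorem theorem2p2 (R : realType) (gamma1 gamma2 : R -> R)
    (hgamma1 : is_kernel gamma1) (hgamma2 : is_kernel gamma2)
    (ell : R) (hell : 0 < ell) :
  exists C : R, 0 < C /\
    forall G : geometry R, admissible G -> gb G - ga G = ell ->
    forall u1 u2 : R -> R,
      cont_on (Omega1_I1 G) u1 ->
      cont_on (Omega2_I2 G) u2 ->
      (forall x, Omega1 G x -> L1 G gamma1 u1 x <= 0) ->
      (forall x, Omega2 G x -> L2 G gamma2 u2 x <= 0) ->
      (forall x, Gamma G x -> u1 x = u2 x) ->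
      (forall x, (I1J G `|` I2J G) x -> flux G gamma1 gamma2 u1 u2 x <= 0) ->
      cb_smooth_on 2 (Omega1_I1D G) u1 ->
      cb_smooth_on 2 (Omega2_I2D G) u2 ->
      (norm_Omega G u1 u2 <=
         C%:E * (norm_ID G u1 u2
                 + norm_Omega G (L1 G gamma1 u1) (L2 G gamma2 u2)
                 + norm_flux G gamma1 gamma2 u1 u2))%E.
Proof.
pose s := Num.min (sigma gamma1) (sigma gamma2).
have s0 : 0 < s by rewrite lt_min !kernel_sigma_gt0.
pose k := 2 * ell ^+ 2 / s.
have k0 : 0 < k by rewrite divr_gt0 // mulr_gt0 // exprn_gt0.
(* The estimate has coefficient [1] on the exterior data and [k] on the operator; [k + 1] dominates
   both and depends only on the kernels and [ell]. *)
exists (k + 1); split; first by rewrite addr_gt0.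
move=> G hG ab u1 u2 c1 c2 _ _ E _ s1 s2.
have [h1 h2 h3 h4] := admissible_bounds hG.
set nA := norm_ID G u1 u2.
set nB := norm_Omega G (L1 _ _ _) _.
set nF := norm_flux _ _ _ _ _.
(* The supremum over an empty set would be [-oo], so each norm is shown nonnegative by exhibiting a
   midpoint of one of its intervals. *)
have nA0 : (0 <= nA)%E.
  rewrite /nA /norm_ID le_max sup_norm_ge0 //; exists (ga G - gdelta1 G / 2).
  by rewrite /I1D /= in_itv /=; lra.
have nB0 : (0 <= nB)%E.
  rewrite /nB /norm_Omega le_max sup_norm_ge0 //; exists ((ga G + galpha G) / 2).
  by rewrite /Omega1 /= in_itv /=; lra.
have nF0 : (0 <= nF)%E.
  rewrite /nF /norm_flux sup_norm_ge0 //; exists (galpha G + gdelta1 G / 2); left.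
  by rewrite /I1J /= in_itv /=; lra.
have k1 : (0 <= (k + 1)%:E)%E by rewrite lee_fin; lra.
apply: (@le_trans _ _ ((k + 1)%:E * (nA + nB))%E); last first.
  by apply: lee_wpmul2l => //; exact: leeDl.
(* If either norm is infinite, the right-hand side is [+oo] because [k + 1 > 0] and the other norm
   is not [-oo]. Otherwise both are real and [fine] loses nothing. *)
have [nAy|nAy] := eqVneq nA +oo%E.
  rewrite nAy addye ?gt0_muley ?leey ?lte_fin //; first lra.
  by rewrite gt_eqF // (lt_le_trans ltNy0).
have [nBy|nBy] := eqVneq nB +oo%E.
  rewrite nBy addey ?gt0_muley ?leey ?lte_fin //; first lra.
  by rewrite gt_eqF // (lt_le_trans ltNy0).
have nAf : nA \is a fin_num by rewrite ge0_fin_numE // ltey.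
have nBf : nB \is a fin_num by rewrite ge0_fin_numE // ltey.
have A0 : 0 <= fine nA by exact: fine_ge0.
have B0 : 0 <= fine nB by exact: fine_ge0.
have [] := @two_sided_estimate _ G hG gamma1 gamma2 u1 u2 (fine nA) (fine nB) s
  hgamma1 hgamma2 c1 c2 E s1 s2 _ _ _ _ B0 s0.
- by move=> x hx; rewrite -lee_fin fineK // /nA /norm_ID le_max sup_norm_ge.
- by move=> x hx; rewrite -lee_fin fineK // /nA /norm_ID le_max sup_norm_ge ?orbT.
- by move=> x hx; rewrite -lee_fin fineK // /nB /norm_Omega le_max sup_norm_ge.
- by move=> x hx; rewrite -lee_fin fineK // /nB /norm_Omega le_max sup_norm_ge ?orbT.
- by rewrite ge_min lexx.
- by rewrite ge_min lexx orbT.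
rewrite ab -/k => b1 b2.
have kAB : fine nA + k * fine nB <= (k + 1) * (fine nA + fine nB) by nra.
rewrite -(fineK nAf) -(fineK nBf) -EFinD -EFinM ge_max.
apply/andP; split; apply: sup_norm_le => x hx; apply: le_trans kAB; [exact: b1|exact: b2].
Qed.
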